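(* Let $G$ be a Deza graph with strongly regular children and adjacency matrix $$M=\begin{pmatrix} M_{11} & M_{12}\\ M_{21} & M_{22}\end{pmatrix},$$ where the vertices are ordered so that $M_{11}$ is the adjacency matrix of an induced subgraph $H$ of $G$. Suppose there exists a Seidel automorphism of $H$ with permutation matrix $P_{11}$ such that $P_{11}M_{11}M_{12}=M_{11}M_{12}$. Let $P=\begin{pmatrix} P_{11} & 0\\ 0 & I\end{pmatrix}$. Then the matrices $$N_1=\begin{pmatrix} P_{11}M_{11} & M_{12}\\ M_{21} & M_{22}\end{pmatrix},\qquad N_2=\begin{pmatrix} P_{11}M_{11} & P_{11}M_{12}\\ M_{21}P_{11} & M_{22}\end{pmatrix}$$ are adjacency matrices of Deza graphs with strongly regular children. Moreover, $N_1^2=M^2$ and $N_2^2=(PMP)^2$.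
   Context: A strongly regular graph with parameters $(n,k,\lambda,\mu)$ is a $k$-regular graph on $n$ vertices in which any two distinct adjacent vertices have exactly $\lambda$ common neighbours and any two distinct non-adjacent vertices have exactly $\mu$ common neighbours. A Deza graph with parameters $(n,k,b,a)$, $b\ge a$, is a $k$-regular connected graph on $n$ vertices such that any two distinct vertices have either $b$ or $a$ common neighbours; equivalently its adjacency matrix $N$ satisfies $N^2=aA+bB+kI$ for symmetric $(0,1)$-matrices $A,B$ with $A+B+I=J$ ($J$ the all-ones matrix). The graphs with adjacency matrices $A$ and $B$ are the children of the Deza graph; ''Deza graph with strongly regular children'' means both children are strongly regular graphs. A Seidel automorphism of a graph is an involutive automorphism $\varphi$ ($\varphi^2=\mathrm{id}$, $\varphi\ne\mathrm{id}$) such that for every vertex $v$ with $\varphi(v)\neq v$, $v$ and $\varphi(v)$ are non-adjacent; its permutation matrix $P_{11}$ has $(P_{11})_{u,v}=1$ iff $v=\varphi(u)$.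
   Formalization: That N1 and N2 are adjacency matrices of Deza graphs is claimed only when H is not all of G or G is not bipartite; for H = G = C_6 with the antipodal map, N1 is two disjoint triangles, hence not connected. The identities for the squares are unrestricted. *)

(* Defs.v *)
From HB Require Import structures.
From mathcomp Require Import all_boot all_order all_fingroup all_algebra.

Set Implicit Arguments.
Unset Strict Implicit.
Unset Printing Implicit Defensive.

Import GRing.Theory.
Local Open Scope ring_scope.

(* A graph on n vertices is a relation on 'I_n satisfying [simple_graph]. *)

Definition simple_graph (n : nat) (e : rel 'I_n) : Prop :=
  symmetric e /\ irreflexive e.

Definition adjmx (n : nat) (e : rel 'I_n) : 'M[int]_n :=
  \matrix_(u, v) (e u v)%:R.

Definition degree (n : nat) (e : rel 'I_n) (u : 'I_n) : nat :=
  #|[set w | e u w]|.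

Definition common_neighbours (n : nat) (e : rel 'I_n) (u v : 'I_n) : nat :=
  #|[set w | e u w && e v w]|.

Definition regular (n : nat) (k : nat) (e : rel 'I_n) : Prop :=
  forall u, degree e u = k.

Definition connected_graph (n : nat) (e : rel 'I_n) : Prop :=
  forall u v, connect e u v.

(* Switching with H = G may disconnect a bipartite graph: for G = C_6 and phi
   the antipodal map, P11 *m M11 is the adjacency matrix of two triangles, which
   is not a Deza graph since Deza graphs are connected. *)
Definition bipartite (n : nat) (e : rel 'I_n) : Prop :=
  exists c : 'I_n -> bool, forall u v, e u v -> c u != c v.

Definition strongly_regular_with (n k lam mu : nat) (e : rel 'I_n) : Prop :=
  [/\ simple_graph e,
      regular k e,
      forall u v, u != v -> e u v -> common_neighbours e u v = lam
    & forall u v, u != v -> ~~ e u v -> common_neighbours e u v = mu].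

Definition strongly_regular (n : nat) (e : rel 'I_n) : Prop :=
  exists k lam mu : nat, strongly_regular_with k lam mu e.

Definition deza_graph (n k b a : nat) (e : rel 'I_n) : Prop :=
  [/\ simple_graph e /\ connected_graph e,
      regular k e,
      (a <= b)%N
    & forall u v, u != v ->
        common_neighbours e u v = b \/ common_neighbours e u v = a].

(* The pair (eA, eB) is determined by e, k, b, a unless a = b. *)
Definition children (n k b a : nat) (e eA eB : rel 'I_n) : Prop :=
  [/\ simple_graph eA,
      simple_graph eB,
      adjmx e *m adjmx e
        = a%:R *: adjmx eA + b%:R *: adjmx eB + k%:R *: 1%:M
    & adjmx eA + adjmx eB + 1%:M = const_mx 1].

Definition deza_with_src (n : nat) (e : rel 'I_n) : Prop :=
  exists (k b a : nat) (eA eB : rel 'I_n),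
    [/\ deza_graph k b a e,
        children k b a e eA eB,
        strongly_regular eA
      & strongly_regular eB].

Definition adjmx_of_deza_with_src (n : nat) (N : 'M[int]_n) : Prop :=
  exists e : rel 'I_n, N = adjmx e /\ deza_with_src e.

Definition automorphism (n : nat) (e : rel 'I_n) (phi : {perm 'I_n}) : Prop :=
  forall u v, e (phi u) (phi v) = e u v.

Definition seidel_automorphism (n : nat) (e : rel 'I_n) (phi : {perm 'I_n})
    : Prop :=
  [/\ automorphism e phi,
      forall v, phi (phi v) = v,
      exists v, phi v != v
    & forall v, phi v != v -> ~~ e v (phi v)].

(* The subgraph induced on the first p vertices. *)
Definition induced_left (p q : nat) (e : rel 'I_(p + q)) : rel 'I_p :=
  fun u v => e (lshift q u) (lshift q v).

(* Main.v *)
Require Import Defs.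
From HB Require Import structures.
From mathcomp Require Import all_boot all_order all_fingroup all_algebra.

Set Implicit Arguments.
Unset Strict Implicit.
Unset Printing Implicit Defensive.

Import GRing.Theory.
Local Open Scope ring_scope.

(** Since [P11] is an involution commuting with [M11], blockwise multiplication
    and [P11 *m M11 *m M12 = M11 *m M12] give [N1 ^ 2 = M ^ 2].  The entries of
    the square of an adjacency matrix are the numbers of common neighbours, so
    the switched graph has the same degree, Deza parameters and children as [G].
    Only connectedness is not determined by the square.  Walks of even length
    are: if [G] is connected and not bipartite any two vertices are joined by
    one; if there is a vertex outside [H], its neighbourhood is not changed by
    the switching, and a walk of odd length to it consists of one of its edges
    and a walk of even length.  Finally [N2 = P *m N1 *m P], so [N2] is the
    adjacency matrix of an isomorphic graph. *)

(** * Common neighbours and walks of even length *)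

Section Walks.

Variable n : nat.
Implicit Types e f : rel 'I_n.

Lemma adjmx_sq e u v : symmetric e ->
  (adjmx e *m adjmx e) u v = (common_neighbours e u v)%:R.
Proof.
move=> se; rewrite mxE /common_neighbours -sum1dep_card natr_sum.
rewrite [RHS]big_mkcond; apply: eq_bigr => w _.
by rewrite !mxE (se w v) -natrM mulnb; case: (_ && _).
Qed.

Lemma common_neighbours_sq e f : symmetric e -> symmetric f ->
  adjmx f *m adjmx f = adjmx e *m adjmx e ->
  forall u v, common_neighbours f u v = common_neighbours e u v.
Proof.
move=> se sf /matrixP eq_sq u v; have := eq_sq u v.
by rewrite !adjmx_sq // => /eqP; rewrite Num.Theory.eqr_nat => /eqP.
Qed.

Lemma degree_common_neighbours e u : degree e u = common_neighbours e u u.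
Proof. by apply: eq_card => w; rewrite !inE andbb. Qed.

(** For symmetric [e], reachability under this relation means being joined by a walk of even
    length. *)
Definition two_step e : rel 'I_n := fun u v => (0 < common_neighbours e u v)%N.

Lemma two_step_mid e x y z : symmetric e -> e x z -> e z y -> two_step e x y.
Proof.
by move=> se xz zy; apply/card_gt0P; exists z; rewrite inE xz se.
Qed.

Lemma two_step_sym e : symmetric (two_step e).
Proof.
move=> u v; rewrite /two_step; congr (0 < _)%N.
by apply: eq_card => w; rewrite !inE andbC.
Qed.

Lemma connect_two_step e : symmetric e ->
  subrel (connect (two_step e)) (connect e).
Proof.
move=> se; apply: connect_sub => u v /card_gt0P[w]; rewrite inE se (se v).
by move=> /andP[wu wv]; apply: (@connect_trans _ _ w); apply: connect1;
   rewrite // se.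
Qed.

(** Induction on the walk, extended at its end: each further edge swaps the two alternatives, which
    stand for even and odd length. *)
Lemma connect_parity e x y : symmetric e -> connect e x y ->
  connect (two_step e) x y \/ exists2 z, connect (two_step e) x z & e z y.
Proof.
move=> se /connectP[s]; elim/last_ind: s y => [|s z IHs] y /=.
  by move=> _ ->; left.
rewrite rcons_path last_rcons => /andP[es ez] ->.
case: (IHs _ es erefl) => [xl|[t xt tl]]; first by right; exists (last x s).
left; apply: connect_trans xt (connect1 _).
exact: two_step_mid tl ez.
Qed.

(** If no even walk joined [u0] to [v0], colouring each vertex by whether an even walk from [u0]
    reaches it would be a proper 2-colouring. *)
Lemma connect_two_step_nonbipartite e : simple_graph e -> connected_graph e ->
  ~ bipartite e -> connected_graph (two_step e).
Proof.
move=> [se _] ce nbip u0 v0; apply/negPn/negP => /negP nuv.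
apply: nbip; exists (connect (two_step e) u0) => u v uv.
have csym := sym_connect_sym (two_step_sym e).
case cu: (connect _ u0 u); case cv: (connect _ u0 v) => //; exfalso.
  (* Both ends coloured true: an even walk from [v0] to [u] continues one from [u0]; for an odd one
     with last edge [z u], [v] is two steps from [z] through [u]. *)
  have vu : e v u by rewrite se.
  case: (connect_parity se (ce v0 u)) => [c|[z c zu]].
    by apply: nuv; apply: connect_trans cu _; rewrite csym.
  apply: nuv; apply: connect_trans cv (connect_trans _ _).
    by apply: connect1; apply: (@two_step_mid e v z u); rewrite // se.
  by rewrite csym.
(* Both ends coloured false: [u] is reached by an odd walk, which the edge to [v] makes even. *)
case: (connect_parity se (ce u0 u)) => [|[z c zu]]; first by rewrite cu.
move/negP: (negbT cv); apply.
by apply: connect_trans c (connect1 _); apply: two_step_mid zu uv.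
Qed.

End Walks.

Lemma connected_graph_sq n (e f : rel 'I_n) :
  simple_graph e -> simple_graph f ->
  adjmx f *m adjmx f = adjmx e *m adjmx e -> connected_graph e ->
  (exists w, forall u, f w u = e w u) \/ ~ bipartite e -> connected_graph f.
Proof.
move=> ge gf eq_sq ce; have [[se _] [sf _]] := (ge, gf).
have eq2 : connect (two_step e) =2 connect (two_step f).
  by apply: eq_connect => u v; rewrite /two_step (common_neighbours_sq se sf).
case=> [[w fw] u v|/(connect_two_step_nonbipartite ge ce) c2 u v]; last first.
  by apply: connect_two_step => //; rewrite -eq2.
have cw x : connect f x w.
  case: (connect_parity se (ce x w)) => [|[z]]; rewrite eq2.
    exact: connect_two_step.
  move/(connect_two_step sf)=> xz zw; apply: connect_trans xz (connect1 _).
  by rewrite sf fw se.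
apply: connect_trans (cw u) _.
by rewrite (sym_connect_sym sf).
Qed.

(** The children of [e] serve for [f] unchanged, since the equation defining them sees only the
    square. *)
Lemma deza_with_src_sq n (e f : rel 'I_n) :
  simple_graph f -> connected_graph f ->
  adjmx f *m adjmx f = adjmx e *m adjmx e ->
  deza_with_src e -> deza_with_src f.
Proof.
move=> gf cf eq_sq [k [b [a [eA [eB [[[ge _] reg leab cn] [gA gB sq J] sA sB]]]]]].
have cnE := common_neighbours_sq ge.1 gf.1 eq_sq.
exists k, b, a, eA, eB; split=> //; split=> //; last 1 first.
- by rewrite eq_sq.
- by move=> u; rewrite degree_common_neighbours cnE -degree_common_neighbours.
by move=> u v; rewrite cnE; apply: cn.
Qed.

(** * Invariance under relabelling the vertices *)

Section Relabelling.

Variables (n : nat) (s : {perm 'I_n}).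
Implicit Types e : rel 'I_n.

Definition relabel e : rel 'I_n := fun u v => e (s u) (s v).

Lemma simple_graph_relabel e : simple_graph e -> simple_graph (relabel e).
Proof. by case=> se ie; split=> [u v|u]; [apply: se | apply: ie]. Qed.

Lemma common_neighbours_relabel e u v :
  common_neighbours (relabel e) u v = common_neighbours e (s u) (s v).
Proof.
rewrite /common_neighbours -[RHS](card_preimset _ (@perm_inj _ s)).
by apply: eq_card => w; rewrite !inE.
Qed.

Lemma regular_relabel k e : regular k e -> regular k (relabel e).
Proof.
move=> reg u; rewrite degree_common_neighbours common_neighbours_relabel.
by rewrite -degree_common_neighbours.
Qed.

Lemma connected_graph_relabel e :
  connected_graph e -> connected_graph (relabel e).
Proof.
move=> ce u v; have /connectP[t] := ce (s u) (s v).
elim: t u => [|x t IHt] u /= => [_ /perm_inj ->|/andP[ux xt]] //.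
(* Each vertex of the walk is the image of its preimage under [s], so the walk pulls back. *)
rewrite -(permKV s x) in ux xt * => last_t.
by apply: connect_trans (connect1 _) (IHt _ xt last_t).
Qed.

Lemma strongly_regular_relabel e :
  strongly_regular e -> strongly_regular (relabel e).
Proof.
move=> [k [lam [mu [ge reg hl hm]]]]; exists k, lam, mu; split.
- exact: simple_graph_relabel.
- exact: regular_relabel.
- move=> u v uv; rewrite common_neighbours_relabel.
  by apply: hl; rewrite (inj_eq perm_inj).
- move=> u v uv; rewrite common_neighbours_relabel.
  by apply: hm; rewrite (inj_eq perm_inj).
Qed.

Lemma deza_with_src_relabel e : deza_with_src e -> deza_with_src (relabel e).
Proof.
move=> [k [b [a [eA [eB [[[ge ce] reg leab cn] [gA gB sq J] sA sB]]]]]].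
exists k, b, a, (relabel eA), (relabel eB).
split; try exact: strongly_regular_relabel; split=> //.
- by split; [apply: simple_graph_relabel | apply: connected_graph_relabel].
- exact: regular_relabel.
- move=> u v uv; rewrite !common_neighbours_relabel.
  by apply: cn; rewrite (inj_eq perm_inj).
- exact: simple_graph_relabel.
- exact: simple_graph_relabel.
- apply/matrixP => u v; rewrite adjmx_sq; last exact: (simple_graph_relabel ge).1.
  rewrite common_neighbours_relabel -adjmx_sq; last exact: ge.1.
  by rewrite sq !mxE (inj_eq perm_inj).
- apply/matrixP => u v; have /matrixP/(_ (s u) (s v)) := J.
  by rewrite !mxE (inj_eq perm_inj).
Qed.

End Relabelling.

(** * Extension of a permutation of the first [p] vertices by the identity *)

Section LeftPermutation.

Variables (p q : nat) (phi : {perm 'I_p}).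

Definition left_fun (u : 'I_(p + q)) : 'I_(p + q) :=
  match split u with inl i => lshift q (phi i) | inr _ => u end.

Lemma left_fun_lshift i : left_fun (lshift q i) = lshift q (phi i).
Proof. by rewrite /left_fun -[lshift q i]/(unsplit (inl i)) unsplitK. Qed.

Lemma left_fun_rshift j : left_fun (rshift p j) = rshift p j.
Proof. by rewrite /left_fun -[rshift p j]/(unsplit (inr j)) unsplitK. Qed.

Lemma left_fun_inj : injective left_fun.
Proof.
move=> u v; case: (split_ordP u) => i ->; case: (split_ordP v) => j ->;
  rewrite ?left_fun_lshift ?left_fun_rshift.
- by move/lshift_inj/perm_inj->.
- by move/eqP; rewrite eq_lrshift.
- by move/eqP; rewrite eq_rlshift.
- by [].
Qed.

(** The permutation whose matrix is the block matrix [P] of the theorem. *)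
Definition left_perm : {perm 'I_(p + q)} := perm left_fun_inj.

End LeftPermutation.

(** * The switched matrices [N1] and [N2] *)

Theorem theorem7 (p q : nat) (G : rel 'I_(p + q))
    (M11 : 'M[int]_p) (M12 : 'M[int]_(p, q))
    (M21 : 'M[int]_(q, p)) (M22 : 'M[int]_q)
    (phi : {perm 'I_p})
    (hG : deza_with_src G)
    (hM : adjmx G = block_mx M11 M12 M21 M22)
    (hphi : seidel_automorphism (induced_left G) phi)
    (hcomm : perm_mx phi *m M11 *m M12 = M11 *m M12) :
  let P11 : 'M[int]_p := perm_mx phi in
  let M := block_mx M11 M12 M21 M22 in
  let P := block_mx P11 0 0 1%:M in
  let N1 := block_mx (P11 *m M11) M12 M21 M22 in
  let N2 := block_mx (P11 *m M11) (P11 *m M12) (M21 *m P11) M22 in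
  ((0 < q)%N \/ ~ bipartite G ->
     adjmx_of_deza_with_src N1 /\ adjmx_of_deza_with_src N2)
  /\ N1 *m N1 = M *m M
  /\ N2 *m N2 = (P *m M *m P) *m (P *m M *m P).
Proof.
move=> P11 M P N1 N2.
have [gG cG] : simple_graph G /\ connected_graph G.
  by case: hG => [k [b [a [eA [eB [[]]]]]]].
have [sG iG] := gG; have [aut inv _ nadj] := hphi.
have /matrixP E := hM.
have E11 i j : M11 i j = (G (lshift q i) (lshift q j))%:R.
  by have := E (lshift q i) (lshift q j); rewrite block_mxEul mxE.
have E12 i j : M12 i j = (G (lshift q i) (rshift p j))%:R.
  by have := E (lshift q i) (rshift p j); rewrite block_mxEur mxE.
have E21 i j : M21 i j = (G (rshift p i) (lshift q j))%:R.
  by have := E (rshift p i) (lshift q j); rewrite block_mxEdl mxE.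
have E22 i j : M22 i j = (G (rshift p i) (rshift p j))%:R.
  by have := E (rshift p i) (rshift p j); rewrite block_mxEdr mxE.
have phiV : phi^-1%g = phi.
  by apply/permP => i; apply: (@perm_inj _ phi); rewrite permKV inv.
have PP : P11 *m P11 = 1%:M.
  by rewrite -perm_mxM -{1}phiV mulVg perm_mx1.
have PT : P11^T = P11 by rewrite tr_perm_mx phiV.
have PM i j : (P11 *m M11) i j = (G (lshift q (phi i)) (lshift q j))%:R.
  by rewrite -row_permE mxE E11.
have swap i j :
    G (lshift q (phi i)) (lshift q j) = G (lshift q i) (lshift q (phi j)).
  by have := aut i (phi j); rewrite /induced_left inv.
have MP : M11 *m P11 = P11 *m M11.
  apply/matrixP => i j; rewrite PM.
  (* [col_permE] involves the inverse permutation, so [phi] is first rewritten as its own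
     inverse. *)
  by rewrite /P11 -[phi in perm_mx phi]phiV -col_permE mxE E11 swap.
have T11 : M11^T = M11 by apply/matrixP => i j; rewrite mxE !E11 sG.
have T12 : M12^T = M21 by apply/matrixP => i j; rewrite mxE E12 E21 sG.
(* The transpose of [hcomm], needed for the lower left block of the square. *)
have hcommT : M21 *m P11 *m M11 = M21 *m M11.
  move/(congr1 trmx): hcomm.
  by rewrite !trmx_mul -/P11 PT T11 T12 MP mulmxA.
have sqN1 : N1 *m N1 = M *m M.
  rewrite /N1 /M !mulmx_block hcomm !mulmxA hcommT.
  by rewrite -(mulmxA P11 M11 P11) MP mulmxA PP mul1mx.
have PPb : P *m P = 1%:M.
  by rewrite /P mulmx_block !mulmx0 !mul0mx !mulmx1 !addr0 add0r PP -scalar_mx_block.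
have N2E : N2 = P *m N1 *m P.
  rewrite /P /N1 !mulmx_block !mulmx0 !mul0mx !mulmx1 !mul1mx !addr0 !add0r.
  by rewrite /N2 mulmxA PP mul1mx MP.
split; last first.
  split=> //; rewrite N2E.
  have conj_sq X : P *m X *m P *m (P *m X *m P) = P *m (X *m X) *m P.
    by rewrite !mulmxA -(mulmxA _ P P) PPb mulmx1.
  by rewrite !conj_sq sqN1.
move=> hq.
pose s := left_perm q phi.
have sl i : s (lshift q i) = lshift q (phi i) by rewrite permE left_fun_lshift.
have sr j : s (rshift p j) = rshift p j by rewrite permE left_fun_rshift.
(* The candidate graph for [N1]: adjacency differs from [G] only inside [H], where one end is moved
   by [phi]. *)
pose f : rel 'I_(p + q) := fun u v => N1 u v == 1.
have bE (b : bool) : (b%:R == 1 :> int) = b by case: b.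
have fll i j : f (lshift q i) (lshift q j) = G (lshift q (phi i)) (lshift q j).
  by rewrite /f block_mxEul PM bE.
have flr i j : f (lshift q i) (rshift p j) = G (lshift q i) (rshift p j).
  by rewrite /f block_mxEur E12 bE.
have fr i v : f (rshift p i) v = G (rshift p i) v.
  by case: (split_ordP v) => j ->;
     rewrite /f ?block_mxEdl ?block_mxEdr ?E21 ?E22 bE.
have gf : simple_graph f.
  split=> [u v|u].
    case: (split_ordP u) => i ->; case: (split_ordP v) => j ->;
    by rewrite ?fll ?flr ?fr // ?swap sG.
  case: (split_ordP u) => i ->; rewrite ?fll ?fr ?iG //.
  (* A loop of [f] at [i] would be an edge of [G] between [i] and [phi i]: a loop if [phi] fixes
     [i], and excluded by the Seidel condition otherwise. *)
  have [->|/nadj] := eqVneq (phi i) i; first by rewrite iG.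
  by rewrite /induced_left sG => /negbTE.
have fE : N1 = adjmx f.
  apply/matrixP => u v; rewrite [RHS]mxE.
  case: (split_ordP u) => i ->; case: (split_ordP v) => j ->;
  by rewrite ?fll ?flr ?fr ?block_mxEul ?block_mxEur ?block_mxEdl ?block_mxEdr
             ?PM ?E12 ?E21 ?E22.
have sqf : adjmx f *m adjmx f = adjmx G *m adjmx G by rewrite -fE hM.
have df : deza_with_src f.
  apply: (deza_with_src_sq gf _ sqf hG).
  apply: (connected_graph_sq gG gf sqf cG).
  (* For positive [q], the first vertex outside [H] keeps its neighbourhood. *)
  by case: hq => [q_gt0|]; [left; exists (rshift p (Ordinal q_gt0)) | right].
split; first by exists f.
exists (relabel s f); split; last exact: deza_with_src_relabel.
have M21P i j : (M21 *m P11) i j = M21 i (phi j).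
  by rewrite /P11 -[phi in perm_mx phi]phiV -col_permE mxE.
apply/matrixP => u v; rewrite [RHS]mxE /relabel.
case: (split_ordP u) => i ->; case: (split_ordP v) => j ->; rewrite ?sl ?sr.
- by rewrite block_mxEul PM fll inv swap.
- by rewrite block_mxEur -row_permE mxE E12 flr.
- by rewrite block_mxEdl M21P E21 fr.
- by rewrite block_mxEdr E22 fr.
Qed.
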